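(* For every $n\ge 0$, the number of hesitating tableaux of length $2n$ whose diagrams all have at most two rows and whose last diagram is a one-row shape $(m)$ for some $m\ge 0$ equals the Baxter number $B_{n+1}$, where \[B_N=\sum_{k=1}^N\frac{\binom{N+1}{k-1}\binom{N+1}{k}\binom{N+1}{k+1}}{\binom{N+1}{1}\binom{N+1}{2}}\] (equivalently, $B_N$ is the number of Baxter permutations of size $N$).
   Context: Partitions are identified with their Ferrers diagrams, and $\lambda\le\mu$ means $\lambda_i\le\mu_i$ for all $i$. A hesitating tableau of length $2n$ is a sequence $(\lambda^{(0)},\dots,\lambda^{(2n)})$ of Ferrers diagrams with $\lambda^{(0)}=\varnothing$ such that for each $i$, the pair of steps from $\lambda^{(2i)}$ to $\lambda^{(2i+2)}$ is one of: (a) $\lambda^{(2i+1)}=\lambda^{(2i)}$ and $\lambda^{(2i+2)}$ is obtained from $\lambda^{(2i+1)}$ by adding one box; (b) $\lambda^{(2i+1)}$ is obtained from $\lambda^{(2i)}$ by removing one box and $\lambda^{(2i+2)}=\lambda^{(2i+1)}$; (c) $\lambda^{(2i+1)}$ is obtained from $\lambda^{(2i)}$ by adding one box and $\lambda^{(2i+2)}$ is obtained from $\lambda^{(2i+1)}$ by removing one box. The shape $(0)$ is the empty shape. A Baxter permutation of size $N$ is a permutation $\sigma$ of $\{1,\dots,N\}$ with no indices $i<j<k$ such that $\sigma(j+1)<\sigma(i)<\sigma(k)<\sigma(j)$ or $\sigma(j)<\sigma(k)<\sigma(i)<\sigma(j+1)$. *)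

(* Defs.v *)
From mathcomp Require Import all_boot all_order all_algebra all_fingroup.
From mathcomp Require Import boolp classical_sets functions cardinality.

Set Implicit Arguments.
Unset Strict Implicit.
Unset Printing Implicit Defensive.

(* The rows of a Ferrers diagram, without trailing empty rows. *)
Definition is_ferrers (la : seq nat) : bool :=
  sorted geq la && (0%N \notin la).

(* For diagrams la and mu. Adding a box below the last row is the case
   i = size la; for i > size la, incr_nth pads with zeros and so does not
   produce a diagram. *)
Definition add_box (la mu : seq nat) : Prop :=
  exists i : nat, mu = incr_nth la i.

Definition hesitating_step (la mu nu : seq nat) : Prop :=
  [\/ mu = la /\ add_box mu nu,
      add_box mu la /\ nu = mu
    | add_box la mu /\ add_box nu mu].

(* Length 2n counts the steps, so there are 2n+1 diagrams. *)
Definition hesitating_tableau (n : nat) (t : n.*2.+1.-tuple (seq nat)) : Prop :=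
  [/\ all is_ferrers t,
      nth [::] t 0 = [::]
    & forall i : nat, (i < n)%N ->
        hesitating_step (nth [::] t i.*2)
                        (nth [::] t i.*2.+1)
                        (nth [::] t i.*2.+2)].

Definition at_most_two_rows (la : seq nat) : bool := (size la <= 2)%N.

Definition one_row (m : nat) : seq nat := if m == 0%N then [::] else [:: m].

Definition two_row_hesitating_tableaux (n : nat) :
    set (n.*2.+1.-tuple (seq nat)) :=
  [set t | [/\ hesitating_tableau t,
               all at_most_two_rows t
             & exists m : nat, last [::] t = one_row m]]%classic.
Arguments two_row_hesitating_tableaux n : clear implicits.

Definition baxter_number (N : nat) : rat :=
  (\sum_(1 <= k < N.+1)
     ('C(N.+1, k.-1)%:R * 'C(N.+1, k)%:R * 'C(N.+1, k.+1)%:R)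
       / ('C(N.+1, 1)%:R * 'C(N.+1, 2)%:R))%R.

(* j1 stands for the position j+1. *)
Definition baxter_perm (N : nat) (s : 'S_N) : bool :=
  ~~ [exists i : 'I_N, exists j : 'I_N, exists j1 : 'I_N, exists k : 'I_N,
        [&& j1 == j.+1 :> nat, i < j, j < k
          & [&& s j1 < s i, s i < s k & s k < s j]
            || [&& s j < s k, s k < s i & s i < s j1]]]%N.

(* Main.v *)
(** The Laurent polynomial [(1 + x) (1 + y) (x + y) / (x y)] has the eight steps
    [(1,0), (0,1), (-1,1)], their opposites, and the null step twice, so the
    unconstrained walks from the origin to [(a, b)] are counted by
    [M_n(a, b) = sum_k C(n,k) C(n,k-a) C(n,k+b)].  The step set is invariant
    under the Weyl group G2, generated by [(a, b) -> (b, a)] and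
    [(a, b) -> (a + b, -b)].

    Reflecting in the subgroup A2 counts the walks confined to the quadrant by a
    signed sum of 6 values of [M_n]; for excursions this is
    [sum_k det (C(n, k + i - j))] for 3x3 determinants, which are the summands of
    the Baxter number.

    A two-row diagram [(a, b)] moves under a pair of hesitating steps by the same
    steps, confined to [0 <= b <= a], except that one null step is lost at
    [a = b], where the reflection of the step to [(a - 1, a + 1)] cancels it.
    Reflecting in G2 counts these walks by 12 values of [M_n]; summed over the
    endpoints [(m, 0)] they telescope, and the symmetries of [M_n] reduce what
    is left to the 6 terms of the quadrant excursions.

    Baxter permutations are generated by inserting the maximum immediately before
    a left-to-right maximum or after a right-to-left maximum, which yields a tree
    labelled by the numbers of these maxima.  The number of descendants of a node
    labelled [(h, k)] expands as [sum q_n(a, b) C(h-1, a) C(k-1, b)], where the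
    coefficients [q_n] satisfy the recurrence of the quadrant walks; the root
    [(1, 1)] gives the excursions. *)
Require Import Defs.
From mathcomp Require Import all_boot all_order all_algebra all_fingroup.
From mathcomp Require Import boolp classical_sets functions cardinality.
From mathcomp Require Import zify ring lra.

Set Implicit Arguments.
Unset Strict Implicit.
Unset Printing Implicit Defensive.

Import Order.TTheory GRing.Theory Num.Theory.

(** * Walks with the steps of (1 + x) (1 + y) (x + y) / (x y) *)

Section LatticeWalks.
Local Open Scope ring_scope.

Definition binz (n : nat) (z : int) : int :=
  if z is Posz m then 'C(n, m)%:Z else 0.

Lemma binzS n z : binz n.+1 z = binz n z + binz n (z - 1).
Proof.
case: z => [[|m]|m] //; first by rewrite /= !bin0.
have -> : m.+1%:Z - 1 = m%:Z by lia.
by rewrite /= binS PoszD.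
Qed.

Lemma binz_lt0 n z : z < 0 -> binz n z = 0.
Proof. by case: z. Qed.

Lemma binz_nat n (m : nat) z : z = m%:Z -> binz n z = 'C(n, m)%:Z.
Proof. by move=> ->. Qed.

Lemma sum_binS (n : nat) (G : nat -> int) :
  \sum_(k < n.+2) 'C(n.+1, k)%:Z * G k =
  \sum_(k < n.+1) 'C(n, k)%:Z * (G k + G k.+1).
Proof.
under [RHS]eq_bigr => k _ do rewrite mulrDr.
rewrite big_split /= big_ord_recl /= !bin0 !mul1r.
under eq_bigr => k _ do rewrite /= binS PoszD mulrDl.
rewrite big_split /= addrA; congr (_ + _).
rewrite [in RHS]big_ord_recl bin0 mul1r; congr (_ + _).
by rewrite big_ord_recr /= bin_small // mul0r addr0.
Qed.

(* The coefficient of [x^a y^b] in [((1 + x) (1 + y) (x + y) / (x y)) ^ n]. *)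
Definition free_walks (n : nat) (a b : int) : int :=
  \sum_(k < n.+1) 'C(n, k)%:Z * (binz n (k%:Z - a) * binz n (k%:Z + b)).

Definition step_sum (F : int -> int -> int) (a b : int) : int :=
  F (a - 1) b + F (a + 1) b + F a (b - 1) + F a (b + 1)
  + F (a - 1) (b + 1) + F (a + 1) (b - 1) + F a b *+ 2.

Lemma free_walks0 a b : free_walks 0 a b = ((a == 0) && (b == 0))%:Z.
Proof.
rewrite /free_walks big_ord_recl big_ord0 bin0 mul1r addr0 /=.
have -> : 0%N%:Z - a = - a by lia.
have -> : 0%N%:Z + b = b by lia.
by case: a b => [[|a]|[|a]] [[|b]|b] //=; rewrite /binz /= ?bin0 ?bin0n.
Qed.

(** Pascal's rule is applied to all three binomials; the eight resulting products are the six moving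
    steps and the null step twice. *)
Lemma free_walksS n a b : free_walks n.+1 a b = step_sum (free_walks n) a b.
Proof.
rewrite /free_walks
  (sum_binS n (fun k => binz n.+1 (k%:Z - a) * binz n.+1 (k%:Z + b))).
rewrite /step_sum /free_walks -!sumrMnl -!big_split /=; apply: eq_bigr => k _.
rewrite !binzS.
rewrite (_ : k%:Z - (a - 1) = k%:Z - a + 1); last by lia.
rewrite (_ : k%:Z - (a + 1) = k%:Z - a - 1); last by lia.
rewrite (_ : k.+1%:Z - a = k%:Z - a + 1); last by lia.
rewrite (_ : k.+1%:Z + b = k%:Z + b + 1); last by lia.
rewrite (_ : k%:Z + (b + 1) = k%:Z + b + 1); last by lia.
rewrite (_ : k%:Z + (b - 1) = k%:Z + b - 1); last by lia.
rewrite !addrK; ring.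
Qed.

Lemma free_walks_large n a b : n%:Z < a -> free_walks n a b = 0.
Proof.
move=> lt_na; rewrite /free_walks big1 // => k _.
by rewrite (binz_lt0 n (z := k%:Z - a)) ?mul0r ?mulr0 //; have := ltn_ord k; lia.
Qed.

Lemma free_walks_swap n a b : free_walks n b a = free_walks n a b.
Proof.
elim: n a b => [|n IH] a b; first by rewrite !free_walks0 andbC.
rewrite !free_walksS /step_sum.
rewrite (IH (a - 1) b) (IH (a + 1) b) (IH a (b - 1)) (IH a (b + 1)).
by rewrite (IH (a - 1) (b + 1)) (IH (a + 1) (b - 1)) (IH a b); ring.
Qed.

(** As for the swap, the induction goes through the recurrence, whose eight steps this reflection
    permutes. *)
Lemma free_walks_refl n a b : free_walks n (a + b) (- b) = free_walks n a b.
Proof.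
elim: n a b => [|n IH] a b.
  by rewrite !free_walks0; congr (nat_of_bool _)%:Z; lia.
rewrite !free_walksS /step_sum.
rewrite -(IH (a - 1) b) -(IH (a + 1) b) -(IH a (b - 1)) -(IH a (b + 1)).
rewrite -(IH (a - 1) (b + 1)) -(IH (a + 1) (b - 1)) -(IH a b).
have e x y x' y' : x = x' -> y = y' -> free_walks n x y = free_walks n x' y'.
  by move=> -> ->.
rewrite (e (a - 1 + b) (- b) (a + b - 1) (- b)); try lia.
rewrite (e (a + 1 + b) (- b) (a + b + 1) (- b)); try lia.
rewrite (e (a + (b - 1)) (- (b - 1)) (a + b - 1) (- b + 1)); try lia.
rewrite (e (a + (b + 1)) (- (b + 1)) (a + b + 1) (- b - 1)); try lia.
rewrite (e (a - 1 + (b + 1)) (- (b + 1)) (a + b) (- b - 1)); try lia.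
rewrite (e (a + 1 + (b - 1)) (- (b - 1)) (a + b) (- b + 1)); try lia.
ring.
Qed.

Lemma free_walks_swapE n a b a' b' :
  a' = b -> b' = a -> free_walks n a b = free_walks n a' b'.
Proof. by move=> -> ->; rewrite free_walks_swap. Qed.

Lemma free_walks_reflE n a b a' b' :
  a' = a + b -> b' = - b -> free_walks n a b = free_walks n a' b'.
Proof. by move=> -> ->; rewrite free_walks_refl. Qed.

(** This symmetry is the conjugate by the swap of the one in [free_walks_refl]. *)
Lemma free_walks_refl2E n a b a' b' :
  a' = - a -> b' = a + b -> free_walks n a b = free_walks n a' b'.
Proof.
move=> -> ->; rewrite -free_walks_swap -(free_walks_refl n b a) addrC.
exact: free_walks_swap.
Qed.

(** Translation invariance carries the recurrence from [free_walks] to every signed sum of its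
    translates. *)
Lemma step_sum_shiftl F u a b :
  step_sum F (a + u) b = step_sum (fun x y => F (x + u) y) a b.
Proof. by rewrite /step_sum !(addrAC a u). Qed.

Lemma step_sum_shiftr F v a b :
  step_sum F a (b + v) = step_sum (fun x y => F x (y + v)) a b.
Proof. by rewrite /step_sum !(addrAC b v). Qed.

(* [sum_w sign(w) M_n((a + 1, b + 1) - w (1, 1))] over the Weyl group A2 of the
   walls [a = -1] and [b = -1]. *)
Definition quadrant_walks (n : nat) (a b : int) : int :=
  free_walks n a b - free_walks n (a - 1) (b + 2)
  - free_walks n (a + 2) (b - 1) + free_walks n (a + 3) b
  + free_walks n a (b + 3) - free_walks n (a + 2) (b + 2).

(* [sum_w sign(w) M_n((a + 2, b + 1) - w (2, 1))] over the Weyl group G2 of the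
   walls [a - b = -1] and [b = -1]. *)
Definition wedge_walks (n : nat) (a b : int) : int :=
  free_walks n a b - free_walks n (a + 1) (b - 1)
  - free_walks n (a + 5) b - free_walks n a (b + 4)
  + free_walks n (a + 1) (b + 4) + free_walks n (a + 5) (b - 1)
  + free_walks n (a + 4) (b + 2) - free_walks n (a + 3) (b + 3)
  - free_walks n (a - 1) (b + 2) - free_walks n (a + 4) (b - 2)
  + free_walks n (a + 3) (b - 2) + free_walks n (a - 1) (b + 3).

Lemma quadrant_walksS n a b :
  quadrant_walks n.+1 a b = step_sum (quadrant_walks n) a b.
Proof.
rewrite /quadrant_walks !free_walksS !(step_sum_shiftl, step_sum_shiftr).
rewrite /step_sum; ring.
Qed.

Lemma wedge_walksS n a b :
  wedge_walks n.+1 a b = step_sum (wedge_walks n) a b.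
Proof.
rewrite /wedge_walks !free_walksS !(step_sum_shiftl, step_sum_shiftr).
rewrite /step_sum; ring.
Qed.

Lemma quadrant_walks0 (a b : nat) :
  quadrant_walks 0 a b = ((a == 0%N) && (b == 0%N))%:Z.
Proof. rewrite /quadrant_walks !free_walks0; lia. Qed.

Lemma wedge_walks0 (a b : nat) :
  (b <= a)%N -> wedge_walks 0 a b = ((a == 0%N) && (b == 0%N))%:Z.
Proof. by move=> le_ba; rewrite /wedge_walks !free_walks0; lia. Qed.

Ltac swapW x y x' y' :=
  match goal with H : forall a b a' b', a' = b -> _ |- _ =>
  rewrite [in LHS](H x y x' y'); [|lia|lia] end.
Ltac reflW x y x' y' :=
  match goal with H : forall a b a' b', a' = a + b -> _ |- _ =>
  rewrite [in LHS](H x y x' y'); [|lia|lia] end.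

Lemma quadrant_walks_swap n a b : quadrant_walks n b a = quadrant_walks n a b.
Proof.
rewrite /quadrant_walks !(free_walks_swap n b) !(free_walks_swap n (b + _)).
ring.
Qed.

(** The reflection [(a, b) -> (a + b, -b)] pairs the six terms with opposite signs; each rewrite
    matches one pair. *)
Lemma quadrant_walks_wall n a : quadrant_walks n a (- 1) = 0.
Proof.
rewrite /quadrant_walks; move: (free_walks n) (@free_walks_reflE n) (@free_walks_swapE n).
move=> F reflE swapE.
reflW a (-1 : int) (a - 1) (- 1 + 2 : int).
reflW (a + 2) (-1 - 1 : int) a (- 1 + 3 : int).
reflW (a + 3) (-1 : int) (a + 2) (- 1 + 2 : int).
ring.
Qed.

Lemma wedge_walks_wall n a : wedge_walks n a (- 1) = 0.
Proof.
rewrite /wedge_walks; move: (free_walks n) (@free_walks_reflE n) (@free_walks_swapE n).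
move=> F reflE swapE.
reflW a (-1 : int) (a - 1) (- 1 + 2 : int).
reflW (a + 1) (-1 - 1 : int) (a - 1) (- 1 + 3 : int).
reflW (a + 5) (-1 : int) (a + 4) (- 1 + 2 : int).
reflW (a + 5) (-1 - 1 : int) (a + 3) (- 1 + 3 : int).
reflW (a + 4) (-1 - 2 : int) (a + 1) (- 1 + 4 : int).
reflW (a + 3) (-1 - 2 : int) (a) (- 1 + 4 : int).
ring.
Qed.

(** Reflecting in the wall [a - b = -1] exchanges the twelve terms in pairs of opposite sign.
    Vanishing on the wall would not suffice: the value at [(a - 1, a + 1)], beyond the wall, is
    needed as well. *)
Lemma wedge_walks_swap n a b :
  wedge_walks n (b - 1) (a + 1) = - wedge_walks n a b.
Proof.
rewrite /wedge_walks; move: (free_walks n) (@free_walks_reflE n) (@free_walks_swapE n).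
move=> F reflE swapE.
swapW (b - 1) (a + 1) (a + 1) (b - 1).
swapW (b - 1 + 1) (a + 1 - 1) a b.
swapW (b - 1 + 5) (a + 1) (a + 1) (b + 4).
swapW (b - 1) (a + 1 + 4) (a + 5) (b - 1).
swapW (b - 1 + 1) (a + 1 + 4) (a + 5) b.
swapW (b - 1 + 5) (a + 1 - 1) a (b + 4).
swapW (b - 1 + 4) (a + 1 + 2) (a + 3) (b + 3).
swapW (b - 1 + 3) (a + 1 + 3) (a + 4) (b + 2).
swapW (b - 1 - 1) (a + 1 + 2) (a + 3) (b - 2).
swapW (b - 1 + 4) (a + 1 - 2) (a - 1) (b + 3).
swapW (b - 1 + 3) (a + 1 - 2) (a - 1) (b + 2).
swapW (b - 1 - 1) (a + 1 + 3) (a + 4) (b - 2).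
ring.
Qed.

(* The formal sum of [wedge_walks n m 0] over [m >= a]: terms of [wedge_walks]
   with the same second argument come in pairs of opposite sign. *)
Definition wedge_tail (n : nat) (a : int) : int :=
  free_walks n a 0 + free_walks n (a + 1) 0 + free_walks n (a + 2) 0
  + free_walks n (a + 3) 0 + free_walks n (a + 4) 0
  - free_walks n (a + 1) (- 1) - free_walks n (a + 2) (- 1)
  - free_walks n (a + 3) (- 1) - free_walks n (a + 4) (- 1)
  - free_walks n a 4
  - free_walks n (a - 1) 2 - free_walks n a 2 - free_walks n (a + 1) 2
  - free_walks n (a + 2) 2 - free_walks n (a + 3) 2
  + free_walks n (a - 1) 3 + free_walks n a 3 + free_walks n (a + 1) 3
  + free_walks n (a + 2) 3 + free_walks n (a + 3) (- 2).

Lemma wedge_tailB n a : wedge_walks n a 0 = wedge_tail n a - wedge_tail n (a + 1).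
Proof.
rewrite /wedge_tail /wedge_walks; move: (free_walks n) => F.
rewrite !add0r addrK.
rewrite (_ : a + 1 + 1 = a + 2); last by lia.
rewrite (_ : a + 1 + 2 = a + 3); last by lia.
rewrite (_ : a + 1 + 3 = a + 4); last by lia.
rewrite (_ : a + 1 + 4 = a + 5); last by lia.
ring.
Qed.

Lemma wedge_tail_large n a : n%:Z + 1 < a -> wedge_tail n a = 0.
Proof.
rewrite /wedge_tail; move: (free_walks n) (@free_walks_large n) => F F0 lt_na.
(* The smallest first argument of the twenty terms is [a - 1], whence the bound [n + 1 < a]. *)
by do 20 (rewrite F0; last by lia); ring.
Qed.

(** With [F = free_walks n], the symmetries move all terms to arguments [a >= b >= 0], where both
    sides become [F 0 0 - 2 F 1 1 + 2 F 3 0 - F 2 2]. *)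
Lemma wedge_tail0 n : wedge_tail n 0 = quadrant_walks n 0 0.
Proof.
rewrite /wedge_tail /quadrant_walks.
move: (free_walks n) (@free_walks_reflE n) (@free_walks_refl2E n)
  (@free_walks_swapE n) => F reflE refl2E swapE.
rewrite !add0r.
rewrite (swapE 0 4 4 0) // (reflE 1 (- 1) 0 1) // (swapE 0 1 1 0) //.
rewrite (reflE 2 (- 1) 1 1) // (reflE 3 (- 1) 2 1) // (reflE 4 (- 1) 3 1) //.
rewrite (refl2E (- 1) 2 1 1) // (swapE 0 2 2 0) // (swapE 1 2 2 1) //.
rewrite (refl2E (- 1) 3 1 2) // (swapE 0 3 3 0) // (swapE 1 3 3 1) //.
rewrite (swapE 2 3 3 2) // (reflE 3 (- 2) 1 2) // (swapE 1 2 2 1) //.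
ring.
Qed.

(** The sum telescopes, and [L] is so large that the remaining tail vanishes. *)
Lemma sum_wedge_walks n L : (n.+1 < L)%N ->
  \sum_(m < L) wedge_walks n m%:Z 0 = quadrant_walks n 0 0.
Proof.
move=> lt_nL; rewrite -wedge_tail0.
have -> : \sum_(m < L) wedge_walks n m%:Z 0 = wedge_tail n 0 - wedge_tail n L.
  elim: L {lt_nL} => [|L IH]; first by rewrite big_ord0 subrr.
  by rewrite big_ord_recr IH /= wedge_tailB -addn1 PoszD addrA subrK.
by rewrite (wedge_tail_large (a := L)) ?subr0 //; lia.
Qed.

(** * Evaluation of the quadrant excursions as a Baxter number *)

Lemma bin_succ (n k : nat) : (k <= n)%N ->
  'C(n, k.+1)%:R = 'C(n, k)%:R * (n - k)%:R / k.+1%:R :> rat.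
Proof.
move=> le_kn; apply: (canRL (mulfK _)); first by rewrite pnatr_eq0.
by rewrite -!natrM mulnC mul_bin_left mulnC.
Qed.

Definition binq n z : rat := (binz n z)%:~R.

Lemma binq_pred (k m : nat) :
  binq (k + m)%N (k%:Z - 1) = 'C((k + m)%N, k)%:R * k%:R / m.+1%:R.
Proof.
apply: (canRL (mulfK _)); first by rewrite pnatr_eq0.
case: k => [|k]; first by rewrite mulr0 /binq binz_lt0 ?mul0r.
rewrite /binq (@binz_nat _ k); last by lia.
rewrite -pmulrn -!natrM [('C(_, k.+1) * _)%N]mulnC mul_bin_left mulnC.
by congr (_ * _)%:R; lia.
Qed.

Lemma binq_pred2 (k m : nat) :
  binq (k + m)%N (k%:Z - 2) = binq (k + m)%N (k%:Z - 1) * (k%:R - 1) / m.+2%:R.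
Proof.
case: k => [|k]; first by rewrite /binq !binz_lt0 ?mul0r.
rewrite (_ : k.+1%:Z - 2 = k%:Z - 1); last by lia.
rewrite (_ : k.+1%:Z - 1 = k%:Z); last by lia.
rewrite addSnnS binq_pred /binq (@binz_nat _ k) // -pmulrn.
by rewrite -[k.+1]addn1 natrD addrK.
Qed.

(** The left side is the expanded 3x3 Toeplitz determinant of the [C(n, k + i - j)]. Every binomial
    is a rational multiple of [C(n, k)], so that the claim becomes an identity of rational functions
    in [k] and [m = n - k]. *)
Lemma det_bin (k m : nat) (n := (k + m)%N) :
  'C(n, k)%:R ^+ 3 - 2 * ('C(n, k)%:R * (binq n (k%:Z - 1) * 'C(n, k.+1)%:R))
    + 'C(n, k.+1)%:R ^+ 2 * binq n (k%:Z - 2)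
    + binq n (k%:Z - 1) ^+ 2 * 'C(n, k.+2)%:R
    - 'C(n, k)%:R * (binq n (k%:Z - 2) * 'C(n, k.+2)%:R)
  = 'C(n.+2, k)%:R * 'C(n.+2, k.+1)%:R * 'C(n.+2, k.+2)%:R
      / ('C(n.+2, 1)%:R * 'C(n.+2, 2)%:R) :> rat.
Proof.
have c1 : 'C(n, k.+1)%:R = 'C(n, k)%:R * m%:R / k.+1%:R :> rat.
  by rewrite bin_succ ?leq_addr // addKn.
have c2 : 'C(n, k.+2)%:R = 'C(n, k.+1)%:R * (m%:R - 1) / k.+2%:R :> rat.
  (* At [m = 0] the factor [m - 1] is negative, but both binomials vanish. *)
  case: m @n c1 => [|m] n c1.
    by rewrite !bin_small ?mul0r // /n; lia.
  by rewrite bin_succ /n; [congr (_ * _ / _); rewrite -[m.+1]addn1 natrD addrK;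
    congr _%:R|]; lia.
have d1 : 'C(n.+2, k.+1)%:R =
  'C(n, k)%:R * n.+1%:R * n.+2%:R / (k.+1%:R * m.+1%:R) :> rat.
  apply: (canRL (mulfK _)); first by rewrite mulf_neq0 // pnatr_eq0.
  rewrite -!natrM; congr _%:R.
  have := mul_bin_diag n.+2 k; have := mul_bin_down n.+1 k.
  rewrite /= (_ : n.+1 - k = m.+1)%N; last by rewrite /n; lia.
  move=> e1 e2.
  rewrite mulnA mulnC [('C(n.+2, _) * _)%N]mulnC -e2 mulnCA -e1.
  by rewrite mulnC [(n.+1 * _)%N]mulnC.
have d0 : 'C(n.+2, k)%:R = 'C(n.+2, k.+1)%:R * k.+1%:R / m.+2%:R :> rat.
  apply: (canRL (mulfK _)); first by rewrite pnatr_eq0.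
  rewrite -!natrM [('C(n.+2, k.+1) * _)%N]mulnC mul_bin_left mulnC.
  by congr (_ * _)%:R; rewrite /n; lia.
have d2 : 'C(n.+2, k.+2)%:R = 'C(n.+2, k.+1)%:R * m.+1%:R / k.+2%:R :> rat.
  rewrite bin_succ; last by rewrite /n; lia.
  by congr (_ * _%:R / _); rewrite /n; lia.
have b2 : 'C(n.+2, 2)%:R = n.+2%:R * n.+1%:R / 2 :> rat.
  by rewrite bin_succ // bin1 subn1.
rewrite b2 bin1 d2 d0 d1 c2 c1 binq_pred2 binq_pred -/n.
rewrite -[k.+2]addn2 -[k.+1]addn1 -[m.+2]addn2 -[m.+1]addn1.
rewrite -[n.+2]addn2 -[n.+1]addn1 /n !natrD.
have k0 : 0 <= k%:R :> rat by [].
have m0 : 0 <= m%:R :> rat by [].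
field; do !(apply/andP; split); lra.
Qed.

Lemma quadrant_walks_origin n :
  quadrant_walks n 0 0 = free_walks n 0 0 - free_walks n 1 1 *+ 2
    + free_walks n 3 0 + free_walks n 0 3 - free_walks n 2 2.
Proof.
rewrite /quadrant_walks.
move: (free_walks n) (@free_walks_reflE n) (@free_walks_refl2E n) => F reflE refl2E.
rewrite !add0r (refl2E (0 - 1) 2 1 1) // (reflE 2 (0 - 1) 1 1) //; ring.
Qed.

(** The summation index is shifted by one to match the corresponding term of the determinant; the
    terms lost at the two ends are zero. *)
Lemma free_walks30 n : free_walks n 3 0 =
  \sum_(k < n.+1) 'C(n, k.+1)%:Z ^+ 2 * binz n (k%:Z - 2).
Proof.
rewrite /free_walks big_ord_recl [RHS]big_ord_recr /=.
have -> : 'C(n, n.+1)%:Z = 0 by rewrite bin_small.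
rewrite [0 ^+ 2]expr2 !mul0r addr0 mulr0 add0r.
apply: eq_bigr => k _; rewrite /bump /= add1n ?addn0.
by rewrite (_ : k.+1%:Z - 3 = k%:Z - 2) /=; [ring | lia].
Qed.

(** Same purpose, with the shift in the opposite direction. *)
Lemma free_walks03 n : free_walks n 0 3 =
  \sum_(k < n.+1) binz n (k%:Z - 1) ^+ 2 * 'C(n, k.+2)%:Z.
Proof.
rewrite /free_walks big_ord_recr [RHS]big_ord_recl /=.
rewrite [X in _ = X + _]mul0r add0r.
rewrite ['C(n, (n + (_ + _))%N)]bin_small; last by rewrite -{1}[n]addn0 ltn_add2l.
rewrite !mulr0 addr0; apply: eq_bigr => k _.
by rewrite addn0 /bump /= add1n subn1 addn3 expr2 mulrA.
Qed.

Lemma quadrant_walks_baxter n :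
  (quadrant_walks n 0 0)%:~R = baxter_number n.+1 :> rat.
Proof.
rewrite quadrant_walks_origin free_walks30 free_walks03 /free_walks.
rewrite -sumrMnl -sumrN -sumrN -!big_split /= rmorph_sum /=.
rewrite /baxter_number big_add1 /= big_mkord; apply: eq_bigr => k _.
have le_kn : (k <= n)%N by rewrite -ltnS.
have := det_bin k (n - k); rewrite subnKC // => <-.
rewrite !addn0 addn1 (addn2 k) /binq.
by rewrite !(rmorphD, rmorphN, rmorphM, rmorphMn, rmorphXn) /= -!pmulrn; ring.
Qed.

End LatticeWalks.

(** * Descendants in the Baxter generating tree *)

Section GeneratingTree.
Local Open Scope ring_scope.

Implicit Types F G : nat -> nat -> int.

(* The number of descendants [n] generations below a node with label
   [(h + 1, k + 1)] in the generating tree with rule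
   (h, k) -> (1, k + 1), ..., (h, k + 1), (h + 1, 1), ..., (h + 1, k). *)
Fixpoint descendants (n h k : nat) : nat :=
  if n is n'.+1 then
    (\sum_(i < h.+1) descendants n' i k.+1
     + \sum_(j < k.+1) descendants n' h.+1 j)%N
  else 1%N.

Definition diffl F h k : int := F h.+1 k - F h k.
Definition diffr F h k : int := F h k.+1 - F h k.

(** This is the coefficient of [C(h, a) C(k, b)] in the Newton expansion of [F]. *)
Definition diff0 (a b : nat) F : int :=
  iter b diffr (iter a diffl F) 0%N 0%N.

Lemma diff0Sl a b F : diff0 a.+1 b F = diff0 a b (diffl F).
Proof. by rewrite /diff0 iterSr. Qed.

Lemma diff0S0 b F : diff0 0 b.+1 F = diff0 0 b (diffr F).
Proof. by rewrite /diff0 iterSr. Qed.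

(** For [a = 0] only the row [h = 0] is sampled. This covers partial sums over [i < h.+1], which
    reduce to a single term in that row. *)
Lemma diff0_ext0l b F G : F 0%N =1 G 0%N -> diff0 0 b F = diff0 0 b G.
Proof.
elim: b F G => [|b IHb] F G eFG; first exact: eFG.
by rewrite !diff0S0; apply: IHb => k; rewrite /diffr !eFG.
Qed.

Lemma diff0_ext a b F G : F =2 G -> diff0 a b F = diff0 a b G.
Proof.
elim: a F G => [|a IHa] F G eFG; first by apply: diff0_ext0l => k.
by rewrite !diff0Sl; apply: IHa => h k; rewrite /diffl !eFG.
Qed.

Lemma diff0Sr a b F : diff0 a b.+1 F = diff0 a b (diffr F).
Proof.
elim: a F => [|a IHa] F; first exact: diff0S0.
rewrite !diff0Sl IHa; apply: diff0_ext => h k.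
by rewrite /diffl /diffr; ring.
Qed.

Lemma diff0_0 a b : diff0 a b (fun _ _ => 0) = 0.
Proof.
elim: a => [|a IHa]; last by rewrite diff0Sl -[RHS]IHa; apply: diff0_ext.
by elim: b => [|b IHb] //; rewrite diff0Sr -[RHS]IHb; apply: diff0_ext.
Qed.

Lemma diff0D a b F G :
  diff0 a b (fun h k => F h k + G h k) = diff0 a b F + diff0 a b G.
Proof.
elim: a b F G => [|a IHa] b F G; last first.
  rewrite !diff0Sl -IHa; apply: diff0_ext => h k; rewrite /diffl; ring.
elim: b F G => [|b IHb] F G //; rewrite !diff0Sr -IHb.
by apply: diff0_ext => h k; rewrite /diffr; ring.
Qed.

Lemma diff0_shiftl a b F :
  diff0 a b (fun h => F h.+1) = diff0 a b F + diff0 a.+1 b F.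
Proof.
by rewrite diff0Sl -diff0D; apply: diff0_ext => h k; rewrite /diffl; ring.
Qed.

Lemma diff0_shiftr a b F :
  diff0 a b (fun h k => F h k.+1) = diff0 a b F + diff0 a b.+1 F.
Proof.
by rewrite diff0Sr -diff0D; apply: diff0_ext => h k; rewrite /diffr; ring.
Qed.

(** The difference of the partial sums is the shifted function, so their coefficient at [a.+1] is
    that of the shift at [a]. *)
Lemma diff0_suml a b F :
  diff0 a b (fun h k => \sum_(i < h.+1) F i k) =
  diff0 a b F + (if a is a'.+1 then diff0 a' b F else 0).
Proof.
case: a => [|a].
  by rewrite addr0; apply: diff0_ext0l => k; rewrite big_ord1.
rewrite diff0Sl addrC -(diff0_shiftl a b F); apply: diff0_ext => h k.
by rewrite /diffl big_ord_recr /=; ring.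
Qed.

Lemma diff0_sumr a b F :
  diff0 a b (fun h k => \sum_(j < k.+1) F h j) =
  diff0 a b F + (if b is b'.+1 then diff0 a b' F else 0).
Proof.
case: b => [|b].
  rewrite addr0; elim: a F => [|a IHa] F; first by rewrite /diff0 /= big_ord1.
  rewrite !diff0Sl -[RHS]IHa; apply: diff0_ext => h k.
  by rewrite /diffl sumrB.
rewrite diff0Sr addrC -(diff0_shiftr a b F); apply: diff0_ext => h k.
by rewrite /diffr big_ord_recr /=; ring.
Qed.

(** On Newton coefficients a shift acts as [1 + up] and a partial sum as [1 + down], where [up] and
    [down] read the next and the previous coefficient. The tree rule is thus [(1 + down_a) (1 +
    up_b) + (1 + up_a) (1 + down_b)], which expands into the eight walk steps. *)
Lemma diff0_descendants n (a b : nat) :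
  diff0 a b (fun h k => (descendants n h k)%:Z) = quadrant_walks n a b.
Proof.
elim: n a b => [|n IH] a b.
  rewrite quadrant_walks0; case: a => [|a]; last first.
    rewrite diff0Sl; apply: (etrans _ (diff0_0 a b)); exact: diff0_ext.
  case: b => [|b] //; rewrite diff0Sr; apply: (etrans _ (diff0_0 0 b)).
  exact: diff0_ext.
pose F h k := (descendants n h k)%:Z.
rewrite (@diff0_ext _ _ _ (fun h k => \sum_(i < h.+1) F i k.+1
  + \sum_(j < k.+1) F h.+1 j)); last first.
  by move=> h k; rewrite /= PoszD !(big_morph Posz PoszD (erefl _)).
rewrite diff0D (diff0_suml a b (fun h k => F h k.+1)).
rewrite (diff0_sumr a b (fun h => F h.+1)).
rewrite quadrant_walksS /step_sum.
have wl y : quadrant_walks n (- 1) y = 0.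
  by rewrite -quadrant_walks_swap quadrant_walks_wall.
have {}IH i j : diff0 i j F = quadrant_walks n i j := IH i j.
move: F (quadrant_walks n) (@quadrant_walks_wall n) wl IH => {}F Q wr wl IH.
rewrite !(diff0_shiftl _ _ F, diff0_shiftr _ _ F) !IH.
have predE (x : nat) : x.+1%:Z - 1 = x by lia.
have succE (x : nat) : x%:Z + 1 = x.+1 by lia.
(* At [a = 0] or [b = 0] the partial sums have no previous coefficient; correspondingly
   [quadrant_walks] is zero at [-1]. *)
case: a b => [|a] [|b]; rewrite ?(diff0_shiftl _ _ F) ?(diff0_shiftr _ _ F);
  rewrite ?IH ?sub0r ?wl ?wr ?predE ?succE; ring.
Qed.

Lemma descendants_root n : (descendants n 0 0)%:Z = quadrant_walks n 0 0.
Proof. by rewrite -(diff0_descendants n 0 0). Qed.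

End GeneratingTree.

(** * Two-row hesitating tableaux as walks *)

Definition two_row_partition (p : nat * nat) := p.2 <= p.1.

Definition covers (p q : nat * nat) :=
  (q == (p.1.+1, p.2)) || (q == (p.1, p.2.+1)).

(** Entries are pairs of an intermediate and a final diagram. Keeping the intermediate one separates
    the two null steps, through the first and the second row; the latter requires [b < a]. *)
Definition double_steps (p : nat * nat) : seq ((nat * nat) * (nat * nat)) :=
  let: (a, b) := p in
  [:: ((a, b), (a.+1, b)), ((a.+1, b), (a, b)) &
   (if b < a then
      [:: ((a, b), (a, b.+1)); ((a.-1, b), (a.-1, b)); ((a, b.+1), (a, b))]
    else [::])
   ++ (if 0 < b then
         [:: ((a, b.-1), (a, b.-1)); ((a.+1, b), (a.+1, b.-1))]
       else [::])
   ++ (if b.+1 < a then [:: ((a, b.+1), (a.-1, b.+1))] else [::])].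

Lemma double_steps_uniq p : uniq (double_steps p).
Proof.
case: p => a b; rewrite /double_steps.
by case: ltnP => ?; case: ltnP => ?; case: ltnP => ? //=;
  rewrite !inE !xpair_eqE; lia.
Qed.

Lemma mem_double_steps p q r : two_row_partition p ->
  ((q, r) \in double_steps p) =
  [&& two_row_partition q, two_row_partition r &
    [|| (q == p) && covers q r, covers q p && (r == q)
      | covers p q && covers r q]].
Proof.
case: p q r => [a b] [c d] [e f].
rewrite /two_row_partition /covers /double_steps !xpair_eqE /= => le_ba.
apply/idP/idP.
  case: ltnP => ?; case: ltnP => ?; case: ltnP => ? /=; rewrite !inE => H;
    by repeat (case/orP: H => H); case/andP: H => /eqP[-> ->] /eqP[-> ->]; lia.
case/and3P=> le_dc le_fe /or3P[]/andP[].
- case/andP=> /eqP-> /eqP-> /orP[] /andP[/eqP e1 /eqP e2]; subst e f.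
    by rewrite !inE eqxx.
  by case: ltnP => ?; rewrite ?inE ?eqxx ?orbT //; lia.
- case/orP=> /andP[/eqP e1 /eqP e2] /andP[/eqP-> /eqP->]; subst a b.
    by rewrite ltnS le_dc !inE /= eqxx !orbT.
  by case: ltnP => ? /=; rewrite !inE eqxx !orbT.
- case/orP=> /andP[/eqP ? /eqP ?] /orP[] /andP[/eqP e1 /eqP e2]; subst c d.
  + by case: e1 e2 => <- <-; rewrite !inE eqxx !orbT.
  + by subst b e; case: ltnP => ? /=; rewrite !inE eqxx !orbT.
  + subst a f; case: ltnP => ?; last by lia.
    by rewrite (_ : b.+1 < e.+1 = true) // !(inE, mem_cat) eqxx !orbT.
  + case: e2 e1 => <- <-; case: ltnP => ?; last by lia.
    by rewrite !inE eqxx !orbT.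
Qed.

Definition two_row_diagram (p : nat * nat) : seq nat :=
  if p.2 == 0 then one_row p.1 else [:: p.1; p.2].

Definition rows (la : seq nat) : nat * nat := (nth 0 la 0, nth 0 la 1).

Lemma two_row_diagramK p : two_row_partition p -> rows (two_row_diagram p) = p.
Proof.
case: p => [a [|b]]; rewrite /two_row_partition /two_row_diagram //= /one_row.
by case: a.
Qed.

Lemma rowsK la : is_ferrers la -> at_most_two_rows la ->
  two_row_diagram (rows la) = la.
Proof.
rewrite /is_ferrers /at_most_two_rows.
case: la => [|a [|b [|c la]]] //=; first by case: a.
by case: b => [|b]; rewrite // !inE orbT andbF.
Qed.

Lemma rows_partition la : is_ferrers la -> two_row_partition (rows la).
Proof.
by rewrite /is_ferrers /two_row_partition; case: la => [|a [|b la]] //= /andP[/andP[]].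
Qed.

Lemma two_row_diagram_ferrers p : two_row_partition p ->
  is_ferrers (two_row_diagram p) && at_most_two_rows (two_row_diagram p).
Proof.
rewrite /two_row_partition /two_row_diagram /one_row /is_ferrers.
by case: p => [[|a] [|b]] //= le_ba; rewrite andbT; move: le_ba => /= ->.
Qed.

Lemma add_box_two_row p q : two_row_partition p -> two_row_partition q ->
  add_box (two_row_diagram p) (two_row_diagram q) <-> covers p q.
Proof.
move=> part_p part_q; split=> [[i def_q]|].
  have e := two_row_diagramK part_p; have := two_row_diagramK part_q.
  rewrite def_q /rows !nth_incr_nth.
  rewrite -[nth _ _ 0]/(rows (two_row_diagram p)).1.
  rewrite -[nth _ _ 1]/(rows (two_row_diagram p)).2 e.
  case: i def_q => [|[|i]] def_q <-; rewrite /covers ?eqxx ?orbT //=.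
  (* A box added at an index of at least 2 would create a third row. *)
  have /andP[_] := two_row_diagram_ferrers part_q.
  have /andP[_] := two_row_diagram_ferrers part_p.
  rewrite /at_most_two_rows def_q size_incr_nth; case: ifP; lia.
case/orP=> /eqP def_q; [exists 0 | exists 1]; move: part_p part_q; rewrite def_q;
  by case: p {def_q} => [[|a] [|b]].
Qed.

Lemma hesitating_step_two_row p q r :
  two_row_partition p -> two_row_partition q -> two_row_partition r ->
  hesitating_step (two_row_diagram p) (two_row_diagram q) (two_row_diagram r)
  <-> (q, r) \in double_steps p.
Proof.
move=> part_p part_q part_r; rewrite mem_double_steps // part_q part_r /=.
rewrite /hesitating_step.
have inj x y : two_row_partition x -> two_row_partition y ->
    two_row_diagram x = two_row_diagram y -> x = y.
  by move=> part_x part_y e; rewrite -(two_row_diagramK part_x) e two_row_diagramK.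
split.
  case=> -[h1 h2].
  - have e := inj _ _ part_q part_p h1; subst q.
    by rewrite eqxx (iffLR (add_box_two_row part_p part_r) h2).
  - have e := inj _ _ part_r part_q h2; subst r.
    by rewrite eqxx (iffLR (add_box_two_row part_q part_p) h1) orbT.
  - rewrite (iffLR (add_box_two_row part_p part_q) h1).
    by rewrite (iffLR (add_box_two_row part_r part_q) h2) !orbT.
case/or3P=> /andP[].
- by move=> /eqP-> h; constructor 1; split=> //; apply/add_box_two_row.
- by move=> h /eqP->; constructor 2; split=> //; apply/add_box_two_row.
- by move=> h1 h2; constructor 3; split; apply/add_box_two_row.
Qed.

Fixpoint double_walks (n : nat) (p : nat * nat) : seq (seq (nat * nat)) :=
  if n is n'.+1 then
    [seq [:: p, m.1 & s] | m <- double_steps p, s <- double_walks n' m.2]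
  else [:: [:: p]].

Lemma double_walks_head n p s : s \in double_walks n p -> s = p :: behead s.
Proof.
by case: n => [|n] /=; [rewrite inE => /eqP-> | case/allpairsPdep=> m [t [_ _ ->]]].
Qed.

Lemma double_walks_uniq n p : uniq (double_walks n p).
Proof.
elim: n p => [|n IH] p //=; apply: allpairs_uniq_dep => //.
  exact: double_steps_uniq.
move=> [m s] [m' s'] /allpairsPdep[m1 [s1 [_ s1P [-> ->]]]].
case/allpairsPdep=> m2 [s2 [_ s2P [-> ->]]] [em es].
move: s2P; rewrite -es => /double_walks_head h2.
(* The end of the double step is not listed separately: it is the head of the remaining walk. *)
have e2 : m1.2 = m2.2.
  by move/double_walks_head: s1P; rewrite {1}h2; case.
by case: m1 m2 em e2 {s1P h2} => [x y] [x' y'] /= -> ->.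
Qed.

Lemma double_walks_partition n p s : two_row_partition p ->
  s \in double_walks n p -> all two_row_partition s.
Proof.
elim: n p s => [|n IH] p s part_p /=; first by rewrite inE => /eqP->; rewrite /= part_p.
case/allpairsPdep=> [[q r] [t [m_in t_in ->]]] /=.
move: m_in; rewrite mem_double_steps // => /and3P[part_q part_r _].
by rewrite part_p part_q (IH r).
Qed.

Lemma mem_double_walks n p (t : seq (seq nat)) : two_row_partition p ->
  t \in [seq map two_row_diagram s | s <- double_walks n p] <->
  [/\ size t = n.*2.+1, all is_ferrers t /\ all at_most_two_rows t,
      nth [::] t 0 = two_row_diagram p
    & forall i, i < n ->
        hesitating_step (nth [::] t i.*2)
                        (nth [::] t i.*2.+1)
                        (nth [::] t i.*2.+2)].
Proof.
elim: n p t => [|n IH] p t part_p.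
  rewrite /= inE; split.
    move=> /eqP->; split=> //=.
    by have /andP[-> ->] := two_row_diagram_ferrers part_p.
  by case; case: t => [|x [|y t]] //= _ _ -> _.
split.
  case/mapP=> s /= /allpairsPdep[[q r] [u [m_in u_in ->]]] ->.
  move: (m_in); rewrite mem_double_steps // => /and3P[part_q part_r _].
  have [size_u [fer_u two_u] head_u step_u] := iffLR (IH r _ part_r) (map_f _ u_in).
  have [/andP[p1 p2] /andP[q1 q2]] :=
    (two_row_diagram_ferrers part_p, two_row_diagram_ferrers part_q).
  split=> //=; first by rewrite size_u.
    by rewrite p1 p2 q1 q2.
  case=> [|i] lt_in; last exact: step_u.
  by rewrite /= head_u; apply/hesitating_step_two_row.
case; case: t => [|x [|y t]] //= [size_t] [/and3P[x1 y1 t1] /and3P[x2 y2 t2]].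
move=> def_x step_t.
have part_y : two_row_partition (rows y) by exact: rows_partition.
case: t => [|z t] // in size_t t1 t2 step_t *.
have /andP[z1 _] := t1; have /andP[z2 _] := t2.
have part_z : two_row_partition (rows z) by exact: rows_partition.
have /mapP[u u_in def_u] :
    z :: t \in [seq map two_row_diagram s | s <- double_walks n (rows z)].
  apply/IH => //; split=> //; first by rewrite /= rowsK.
  by move=> i lt_in; apply: (step_t i.+1).
apply/mapP; exists [:: p, rows y & u]; last first.
  by rewrite /= -def_u def_x rowsK.
apply/allpairsPdep; exists (rows y, rows z), u; split=> //.
apply/hesitating_step_two_row => //; rewrite !rowsK // -def_x.
exact: (step_t 0).
Qed.

Lemma two_row_diagram_one_row p :
  (exists m, two_row_diagram p = one_row m) <-> p.2 == 0.
Proof.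
split=> [[m]|]; last by rewrite /two_row_diagram => ->; exists p.1.
by rewrite /two_row_diagram /one_row; case: eqP => // _; case: eqP.
Qed.

Definition final_one_row (s : seq (nat * nat)) := (last (0, 0) s).2 == 0.

Lemma card_tableaux n :
  (two_row_hesitating_tableaux n #=
     `I_(count final_one_row (double_walks n (0%N, 0%N))))%card.
Proof.
have part0 : two_row_partition (0, 0) by [].
pose W := double_walks n (0, 0).
pose L := [seq map two_row_diagram s | s <- W & final_one_row s].
have size_L : size L = count final_one_row W.
  by rewrite size_map size_filter.
have uniq_L : uniq L.
  rewrite map_inj_in_uniq ?filter_uniq ?double_walks_uniq //.
  apply: (can_in_inj (g := map rows)) => s; rewrite mem_filter => /andP[_].
  move/(double_walks_partition part0)/allP=> part_s.
  rewrite -map_comp -[RHS]map_id; apply/eq_in_map => p /part_s.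
  exact: two_row_diagramK.
have mem_L (t : n.*2.+1.-tuple (seq nat)) :
    two_row_hesitating_tableaux n t <-> tval t \in L.
  split=> [[[fer_t head_t step_t] two_t last_t]|].
    have /mapP[s s_in def_t] : tval t \in map (map two_row_diagram) W.
      by apply/mem_double_walks => //; rewrite size_tuple.
    apply/mapP; exists s => //; rewrite mem_filter s_in andbT.
    apply/two_row_diagram_one_row; move: last_t.
    (* The default [[::]] is the image of the default [(0, 0)], as [last_map] requires. *)
    by rewrite def_t -[[::]]/(two_row_diagram (0, 0)) last_map.
  case/mapP=> s; rewrite mem_filter => /andP[fin_s s_in] def_t.
  have : tval t \in map (map two_row_diagram) W by rewrite def_t map_f.
  case/mem_double_walks => // _ [fer_t two_t] head_t step_t; split=> //.
  rewrite def_t -[[::]]/(two_row_diagram (0, 0)) last_map.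
  exact/two_row_diagram_one_row.
(* The bijection sends a tableau to its position in the duplicate-free list [L]. *)
rewrite -size_L; apply/card_set_bijP; exists (fun t => index (tval t) L); split.
- by move=> t /mem_L t_in; rewrite /= index_mem.
- move=> t u; rewrite !inE => /mem_L t_in /mem_L u_in e; apply: val_inj.
  by rewrite /= -[LHS](nth_index [::] t_in) e nth_index.
- move=> i /= lt_iL; have t_in := mem_nth [::] lt_iL.
  have size_t : size (nth [::] L i) == n.*2.+1.
    case/mapP: t_in => s; rewrite mem_filter => /andP[_ s_in] ->.
    have := map_f (map two_row_diagram) s_in.
    by case/mem_double_walks=> // ->.
  exists (Tuple size_t); first exact/mem_L.
  by rewrite /= index_uniq.
Qed.

(** * Counting the two-row walks by endpoint *)

Section TableauCount.
Local Open Scope ring_scope.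

Lemma sum_double_walksS (phi : nat * nat -> int) n p :
  \sum_(s <- double_walks n.+1 p) phi (last (0, 0)%N s) =
  \sum_(m <- double_steps p) \sum_(s <- double_walks n m.2) phi (last (0, 0)%N s).
Proof.
rewrite [LHS]big_allpairs_dep; apply: eq_bigr => m _.
by apply: eq_big_seq => s /double_walks_head ->.
Qed.

(** Walks are built from the front, whereas the recurrence in the endpoint splits off the last
    double step. A general [phi] lets the induction absorb that step into the weight. *)
Lemma sum_double_walksSr (phi : nat * nat -> int) n p :
  \sum_(s <- double_walks n.+1 p) phi (last (0, 0)%N s) =
  \sum_(s <- double_walks n p)
    \sum_(m <- double_steps (last (0, 0)%N s)) phi m.2.
Proof.
elim: n p => [|n IH] p.
  rewrite sum_double_walksS big_seq1; apply: eq_bigr => m _.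
  by rewrite big_seq1.
rewrite sum_double_walksS (eq_bigr _ (fun m _ => IH m.2)).
by rewrite (sum_double_walksS (fun y => \sum_(m <- double_steps y) phi m.2)).
Qed.

Definition at_point (a b : int) (p : nat * nat) : int :=
  ((p.1%:Z == a) && (p.2%:Z == b))%:Z.

(** Each step is read backwards from [(a, b)]. Inside the wedge the guards of [double_steps] hold
    automatically, except that of the second null step, which fails on the diagonal and causes the
    correction. *)
Lemma sum_double_steps_at (a b : nat) p :
  two_row_partition p -> (b <= a)%N ->
  \sum_(m <- double_steps p) at_point a b m.2 =
  step_sum (fun x y => at_point x y p) a b - (a == b)%:Z * at_point a b p.
Proof.
case: p => c d; rewrite /two_row_partition /= => le_dc le_ba.
pose f := at_point a b.
have e1 : at_point (a%:Z - 1) b (c, d) = f (c.+1, d).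
  by rewrite /f /at_point /=; lia.
have e2 : at_point a (b%:Z - 1) (c, d) = if (d < c)%N then f (c, d.+1) else 0.
  by rewrite /f /at_point /=; case: ltnP => ?; lia.
have e3 : at_point (a%:Z + 1) b (c, d) = if (d < c)%N then f (c.-1, d) else 0.
  by rewrite /f /at_point /=; case: ltnP => ?; lia.
have e4 : at_point a (b%:Z + 1) (c, d) = if (0 < d)%N then f (c, d.-1) else 0.
  by rewrite /f /at_point /=; case: ltnP => ?; lia.
have e5 : at_point (a%:Z - 1) (b%:Z + 1) (c, d) =
    if (0 < d)%N then f (c.+1, d.-1) else 0.
  by rewrite /f /at_point /=; case: ltnP => ?; lia.
have e6 : at_point (a%:Z + 1) (b%:Z - 1) (c, d) =
    if (d.+1 < c)%N then f (c.-1, d.+1) else 0.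
  by rewrite /f /at_point /=; case: ltnP => ?; lia.
have e7 : (a == b)%:Z * f (c, d) = if (d < c)%N then 0 else f (c, d).
  by rewrite /f /at_point /=; case: ltnP => ?; case: eqP => ?; lia.
rewrite /step_sum e1 e2 e3 e4 e5 e6 e7 -/f /double_steps.
move: f {e1 e2 e3 e4 e5 e6 e7} => f.
by case: ifP => _; case: ifP => _; case: ifP => _;
  rewrite /= !big_cons big_nil /=; ring.
Qed.

Definition walks_ending_at n (a b : int) : int :=
  \sum_(s <- double_walks n (0, 0)%N) at_point a b (last (0, 0)%N s).

Lemma last_double_walks_partition n p x s : two_row_partition p ->
  s \in double_walks n p -> two_row_partition (last x s).
Proof.
move=> part_p s_in; apply: (allP (double_walks_partition part_p s_in)).
rewrite (double_walks_head s_in) /=; exact: mem_last.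
Qed.

Lemma walks_ending_atS n (a b : nat) : (b <= a)%N ->
  walks_ending_at n.+1 a b =
  step_sum (walks_ending_at n) a b - (a == b)%:Z * walks_ending_at n a b.
Proof.
move=> le_ba; rewrite /walks_ending_at sum_double_walksSr mulr_sumr.
rewrite /step_sum -sumrMnl -!big_split -sumrB /=.
apply: eq_big_seq => s s_in; apply: sum_double_steps_at => //.
exact: last_double_walks_partition s_in.
Qed.

Lemma walks_ending_at_out n a b : ~~ (0 <= b <= a) -> walks_ending_at n a b = 0.
Proof.
move=> out; apply: big1_seq => s /andP[_ s_in].
have := @last_double_walks_partition n (0, 0)%N (0, 0)%N s isT s_in.
move: (last _ s) => [c d]; rewrite /two_row_partition /at_point /=; lia.
Qed.

(** The reflection of [wedge_walks_swap] fixes these points, so the value equals its own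
    opposite. *)
Lemma wedge_walks_diag n (b : int) : wedge_walks n (b - 1) b = 0.
Proof.
have := wedge_walks_swap n (b - 1) b; rewrite subrK.
by set x := wedge_walks n (b - 1) b; clearbody x; lia.
Qed.

Lemma walks_ending_atE n (a b : nat) : (b <= a)%N ->
  walks_ending_at n a b = wedge_walks n a b.
Proof.
elim: n a b => [|n IH] a b le_ba.
  by rewrite wedge_walks0 // /walks_ending_at big_seq1 /at_point /=; lia.
rewrite walks_ending_atS // wedge_walksS.
have eW (x y : int) : walks_ending_at n x y =
    if 0 <= y <= x then wedge_walks n x y else 0.
  case: ifP => [in_xy|/negbT]; last exact: walks_ending_at_out.
  case: x y in_xy => [x|x] [y|y] in_xy; try lia.
  by apply: IH; lia.
have diag := wedge_walks_diag n; have wall := wedge_walks_wall n.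
have swap := wedge_walks_swap n.
move: (walks_ending_at n) (wedge_walks n) eW diag wall swap => G F eW diag wall swap.
have h1 : G (a%:Z - 1) b = F (a%:Z - 1) b.
  rewrite eW; case: ifP => // out.
  by rewrite (_ : a%:Z = b); [rewrite diag | lia].
have h2 : G a (b%:Z - 1) = F a (b%:Z - 1).
  rewrite eW; case: ifP => // out.
  by rewrite (_ : b%:Z = 0); [rewrite sub0r wall | lia].
have h3 : G (a%:Z + 1) b = F (a%:Z + 1) b by rewrite eW ifT //; lia.
have h4 : G a (b%:Z + 1) = F a (b%:Z + 1).
  rewrite eW; case: ifP => // out.
  by rewrite -[a%:Z](addrK 1) (_ : a%:Z = b); [rewrite diag | lia].
(* For [a = b] this neighbour lies beyond the wall, where [swap] gives [- F a a]: exactly the lost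
   null step. The other neighbours outside the wedge lie on a wall, where [F] is zero. *)
have h5 : G (a%:Z - 1) (b%:Z + 1) = F (a%:Z - 1) (b%:Z + 1) + (a == b)%:Z * F a b.
  rewrite eW; case: eqP => [->|ne_ab].
    by rewrite ifF; [rewrite swap mul1r addNr | lia].
  rewrite mul0r addr0; case: ifP => // out.
  by rewrite (_ : a%:Z = b%:Z + 1); [rewrite diag | lia].
have h6 : G (a%:Z + 1) (b%:Z - 1) = F (a%:Z + 1) (b%:Z - 1).
  rewrite eW; case: ifP => // out.
  by rewrite (_ : b%:Z = 0); [rewrite sub0r wall | lia].
have h7 : G a b = F a b by rewrite eW ifT //; lia.
by rewrite /step_sum h1 h2 h3 h4 h5 h6 h7; ring.
Qed.

Lemma count_final_one_row n :
  (count final_one_row (double_walks n (0, 0)%N))%:Z = quadrant_walks n 0 0.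
Proof.
(* [L] exceeds both [n.+1], for the telescoping, and the first row of every endpoint, so that each
   walk is counted. *)
pose L := (n + \max_(s <- double_walks n (0, 0)%N) (last (0, 0)%N s).1).+2.
have lt_nL : (n.+1 < L)%N by rewrite /L ltnS ltnS leq_addr.
rewrite -(sum_wedge_walks lt_nL) -sum1_count.
rewrite (eq_bigr _ (fun (m : 'I_L) _ => esym (walks_ending_atE n (leq0n m)))).
rewrite /walks_ending_at exchange_big /= (big_morph Posz PoszD (erefl _)).
rewrite big_mkcond; apply: eq_big_seq => s s_in.
have lt_sL : ((last (0, 0)%N s).1 < L)%N.
  rewrite /L !ltnS ltnW // ltnS.
  by apply: leq_trans (leq_addl _ _); apply: leq_bigmax_seq.
rewrite (bigD1 (Ordinal lt_sL)) //= big1 ?addr0.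
  by rewrite /at_point /final_one_row /= eqxx; case: eqP => [->|/eqP/negbTE] //=; lia.
move=> i; rewrite -val_eqE /at_point /=; lia.
Qed.

End TableauCount.

(** * Insertion of the maximum in a Baxter permutation *)

Definition baxter_fun (m : nat) (f : nat -> nat) : Prop :=
  forall i j k, i < j -> j < k -> k < m ->
    ~ (f j.+1 < f i /\ f i < f k /\ f k < f j) /\
    ~ (f j < f k /\ f k < f i /\ f i < f j.+1).

Definition insert_fun (N p : nat) (f : nat -> nat) (i : nat) : nat :=
  if i < p then f i else if i == p then N else f i.-1.

Lemma insert_fun_lt N p f i : i < p -> insert_fun N p f i = f i.
Proof. by rewrite /insert_fun => ->. Qed.

Lemma insert_fun_eq N p f : insert_fun N p f p = N.
Proof. by rewrite /insert_fun ltnn eqxx. Qed.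

Lemma insert_fun_gt N p f i : p <= i -> insert_fun N p f i.+1 = f i.
Proof. by move=> le_pi; rewrite /insert_fun ltnNge leqW // eqn_leq ltnNge le_pi. Qed.

Lemma insert_fun_bump N p f i : insert_fun N p f (bump p i) = f i.
Proof.
rewrite /bump; case: leqP => [le_pi|lt_ip]; first exact: insert_fun_gt.
exact: insert_fun_lt.
Qed.

Section Insertion.
Variables (m N p : nat) (f : nat -> nat).
Hypotheses (lt_fN : forall i, i < m -> f i < N) (le_pm : p <= m).
Let g := insert_fun N p f.

(** A pattern of [f] is broken only if [N] separates its two adjacent entries; [N] then replaces the
    larger of them and gives a pattern of [g]. *)
Lemma baxter_fun_delete : baxter_fun m.+1 g -> baxter_fun m f.
Proof.
move=> bax_g i j k lt_ij lt_jk lt_km.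
case: (eqVneq j.+1 p) => [def_p|ne_jp]; last first.
  have := bax_g (bump p i) (bump p j) (bump p k).
  have -> : (bump p j).+1 = bump p j.+1 by rewrite /bump; lia.
  by rewrite /g !insert_fun_bump; apply; rewrite /bump; lia.
have lt_kN := lt_fN lt_km; have lt_iN : f i < N by apply: lt_fN; lia.
have gi : g i = f i by apply: insert_fun_lt; lia.
have gj : g j = f j by apply: insert_fun_lt; lia.
have gp : g p = N by apply: insert_fun_eq.
have gp1 : g p.+1 = f j.+1 by rewrite def_p; apply: insert_fun_gt.
have gk : g k.+1 = f k by apply: insert_fun_gt; lia.
split=> -[h1 [h2 h3]].
  by have [] := bax_g i p k.+1; lia.
by have [] := bax_g i j k.+1; rewrite ?def_p; lia.
Qed.

(** Here [p] is the position to be taken by the new maximum: immediately before a left-to-right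
    maximum, or, in [right_max], immediately after a right-to-left one. *)
Definition left_max := p < m /\ forall i, i < p -> f i < f p.
Definition right_max := 0 < p /\ forall k, p <= k < m -> f k < f p.-1.

(** In a new pattern [N] must be the larger adjacent entry. At a site of one kind the pattern
    contradicts maximality or persists with [N] replaced by the neighbouring maximum, which
    contradicts [bax_f]. *)
Lemma baxter_fun_insert : left_max \/ right_max -> baxter_fun m f -> baxter_fun m.+1 g.
Proof.
move=> site bax_f i j k lt_ij lt_jk lt_km.
have le_gN x : x < m.+1 -> g x <= N.
  move=> lt_xm; rewrite /g /insert_fun; case: ltnP => ?; last case: eqP => ? //.
    by apply/ltnW/lt_fN; lia.
  by apply/ltnW/lt_fN; lia.
have gi := le_gN i; have gj := le_gN j; have gj1 := le_gN j.+1; have gk := le_gN k.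
have gp : g p = N by exact: insert_fun_eq.
case: (eqVneq j p) => [def_j|ne_jp].
  subst j; rewrite gp; split=> -[h1 [h2 h3]]; last by lia.
  case: k => [|k] // in lt_jk lt_km h1 h2 h3 gk *.
  move: h1 h2 h3; rewrite /g insert_fun_gt // insert_fun_lt // insert_fun_gt // => h1 h2 h3.
  case: site => -[pos_p max_p]; first by have := max_p i lt_ij; lia.
  have lt_kp : f k < f p.-1 by apply: max_p; lia.
  case: (eqVneq i p.-1) => [def_i|ne_i]; first by subst i; lia.
  have ne_kp : k != p by apply/eqP=> def_k; subst k; lia.
  have := bax_f i p.-1 k; rewrite prednK; last by lia.
  by move=> H; have [] := H; lia.
case: (eqVneq j.+1 p) => [def_p|ne_j1p].
  rewrite def_p gp; split=> -[h1 [h2 h3]]; first by lia.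
  have ne_kp : k != p by apply/eqP=> def_k; subst k; lia.
  case: k => [|k] // in lt_jk lt_km h1 h2 h3 gk ne_kp *.
  move: h1 h2 h3; rewrite /g insert_fun_lt; last by lia.
  rewrite insert_fun_gt ?insert_fun_lt; [|lia|lia] => h1 h2 h3.
  case: site => -[pos_p max_p]; last first.
    by have := max_p k; rewrite -def_p /=; lia.
  have lt_ip := max_p i; have ne_kp' : k != p by apply/eqP=> def_k; subst k; lia.
  by have [] := bax_f i j k lt_ij; rewrite ?def_p; lia.
have [def_i|ne_ip] := eqVneq i p.
  by split=> -[h1 [h2 h3]]; subst i; rewrite gp in h1 h2; lia.
have [def_k|ne_kp] := eqVneq k p.
  by split=> -[h1 [h2 h3]]; subst k; rewrite gp in h1 h2 h3; lia.
pose u x := unbump p x.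
have gE x : x != p -> g x = f (u x).
  move=> ne_xp; have e : bump p (u x) = x by rewrite unbumpKcond (negbTE ne_xp).
  by rewrite -{1}e /g insert_fun_bump.
have uj1 : u j.+1 = (u j).+1 by rewrite /u /unbump; lia.
rewrite !gE // uj1; apply: bax_f; rewrite /u /unbump; lia.
Qed.

(** Otherwise some [i < p] has [f i > f p] and some [k >= p] has [f k > f p.-1]. If [f p < f p.-1],
    then [f p.-1, N, f p, f k] is forbidden; if not, [f i, f p.-1, N, f p] is. *)
Lemma baxter_fun_insert_site : (forall i j, i < m -> j < m -> i != j -> f i != f j) ->
  0 < m -> baxter_fun m.+1 g -> left_max \/ right_max.
Proof.
move=> inj_f pos_m bax_g.
have [p0|pos_p] := posnP p; first by left; split=> [|i]; rewrite p0.
have [lt_pm|] := ltnP p m; last first.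
  by move=> le_mp; right; split=> // k; lia.
case: (pselect left_max) => [|not_left]; first by left.
right; split=> // k /andP[le_pk lt_km]; rewrite ltnNge; apply/negP=> ge_k.
apply: not_left; split=> // i lt_ip; rewrite ltnNge; apply/negP=> ge_i.
have ne_ip : f i != f p by apply: inj_f; lia.
have ne_kp : f k != f p.-1 by apply: inj_f; lia.
have ne_pp : f p.-1 != f p by apply: inj_f; lia.
have lt_kN := lt_fN lt_km; have lt_iN : f i < N by apply: lt_fN; lia.
have gi : g i = f i by apply: insert_fun_lt.
have gp' : g p.-1 = f p.-1 by apply: insert_fun_lt; lia.
have gp : g p = N by apply: insert_fun_eq.
have gp1 : g p.+1 = f p by apply: insert_fun_gt.
have gk : g k.+1 = f k by apply: insert_fun_gt.
have [lt_pp|le_pp] := ltnP (f p) (f p.-1).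
  have ne_k : k != p by apply/eqP=> e; subst k; lia.
  by have [] := bax_g p.-1 p k.+1; lia.
have ne_i : i != p.-1 by apply/eqP=> e; subst i; lia.
have := bax_g i p.-1 p.+1; rewrite prednK // => H.
by have [] := H; lia.
Qed.

End Insertion.

(** * Insertion into words and the statistics of their maxima *)

Definition baxter_seq (w : seq nat) : Prop := baxter_fun (size w) (nth 0 w).

Definition insert_at (N p : nat) (w : seq nat) : seq nat :=
  take p w ++ N :: drop p w.

Lemma size_insert_at N p w : size (insert_at N p w) = (size w).+1.
Proof. by rewrite size_cat /= addnS -size_cat cat_take_drop. Qed.

Lemma nth_insert_at N p w i : p <= size w ->
  nth 0 (insert_at N p w) i = insert_fun N p (nth 0 w) i.
Proof.
move=> le_pw; rewrite nth_cat size_take_min (minn_idPl le_pw) /insert_fun.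
case: ltnP => [lt_ip|le_pi]; first by rewrite nth_take.
case: eqVneq => [->|ne_ip]; first by rewrite subnn.
have -> : i - p = (i.-1 - p).+1 by lia.
by rewrite /= nth_drop; congr nth; lia.
Qed.

Lemma perm_insert_at N p w : perm_eq (insert_at N p w) (N :: w).
Proof.
by rewrite /insert_at -{3}(cat_take_drop p w) perm_catC /= perm_cons perm_catC.
Qed.

Lemma rev_insert_at N p w : p <= size w ->
  rev (insert_at N p w) = insert_at N (size w - p) (rev w).
Proof.
move=> le_pw; rewrite /insert_at rev_cat rev_cons cat_rcons.
by rewrite take_rev drop_rev subKn.
Qed.

Lemma eq_baxter_fun m f g : f =1 g -> baxter_fun m f -> baxter_fun m g.
Proof.
by move=> e bax i j k lt_ij lt_jk lt_km; rewrite -!e; apply: bax.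
Qed.

Definition lr_max (w : seq nat) (p : nat) : bool :=
  (p < size w) && all (fun x => x < nth 0 w p) (take p w).

(* The element concerned is [nth 0 w p.-1], the one just before position [p];
   [rl_max w 0] is false. *)
Definition rl_max (w : seq nat) (p : nat) : bool := lr_max (rev w) (size w - p).

Definition active (w : seq nat) (p : nat) : bool := lr_max w p || rl_max w p.

Lemma lr_maxP w p : reflect (left_max (size w) p (nth 0 w)) (lr_max w p).
Proof.
apply: (iffP andP) => -[lt_pw max_p]; split=> //.
  move=> i lt_ip; move/allP: max_p; apply.
  by rewrite -(nth_take 0 lt_ip) mem_nth // size_take lt_pw.
apply/allP=> x /(nthP 0)[i]; rewrite size_take lt_pw => lt_ip <-.
by rewrite nth_take //; apply: max_p.
Qed.

Lemma rl_maxP w p : p <= size w ->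
  reflect (right_max (size w) p (nth 0 w)) (rl_max w p).
Proof.
move=> le_pw; apply: (iffP (lr_maxP _ _)); rewrite /left_max size_rev.
  case=> lt_pw max_p; have pos_p : 0 < p by lia.
  split=> // k /andP[le_pk lt_kw]; have := max_p (size w - k.+1).
  rewrite !nth_rev; [|lia|lia].
  rewrite (_ : size w - (size w - k.+1).+1 = k); last by lia.
  by rewrite (_ : size w - (size w - p).+1 = p.-1); [apply|]; lia.
case=> pos_p max_p; split; first by lia.
move=> i lt_i; rewrite !nth_rev; [|lia|lia].
by rewrite (_ : size w - (size w - p).+1 = p.-1); [apply: max_p|]; lia.
Qed.

Lemma baxter_insert_at N p w : uniq w -> all (fun x => x < N) w -> 0 < size w ->
  p <= size w ->
  baxter_seq (insert_at N p w) <-> baxter_seq w /\ active w p.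
Proof.
move=> uniq_w /all_nthP-/(_ 0)/= lt_wN pos_w le_pw; rewrite /baxter_seq size_insert_at.
have e : nth 0 (insert_at N p w) =1 insert_fun N p (nth 0 w).
  by move=> i; apply: nth_insert_at.
have e' : insert_fun N p (nth 0 w) =1 nth 0 (insert_at N p w) by move=> i.
have actP : active w p <->
    left_max (size w) p (nth 0 w) \/ right_max (size w) p (nth 0 w).
  rewrite /active; split.
    by case/orP=> [/lr_maxP|/(rl_maxP le_pw)]; [left|right].
  by case=> [/lr_maxP->|/(rl_maxP le_pw)->]; rewrite ?orbT.
split=> [/(eq_baxter_fun e) bax|[bax /actP act]].
  split; first exact: baxter_fun_delete bax.
  apply/actP; apply: baxter_fun_insert_site bax => // i j lt_iw lt_jw.
  by rewrite nth_uniq.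
by apply: (eq_baxter_fun e'); apply: baxter_fun_insert.
Qed.

Definition lr_count (w : seq nat) : nat := count (lr_max w) (iota 0 (size w)).

Lemma lr_max_insert_at N p w q : all (fun x => x < N) w -> p <= size w ->
  lr_max (insert_at N p w) q = if q < p then lr_max w q else q == p.
Proof.
move=> /all_nthP-/(_ 0)/= lt_wN le_pw.
have e i := nth_insert_at N i le_pw.
apply/lr_maxP/idP; rewrite /left_max size_insert_at e.
  case=> lt_qw max_q; case: ltnP => [lt_qp|le_pq].
    apply/lr_maxP; split; first by lia.
    move=> i lt_iq; have := max_q i lt_iq.
    by rewrite e !insert_fun_lt //; apply: ltn_trans lt_qp.
  rewrite eqn_leq le_pq andbT leqNgt; apply/negP=> lt_pq.
  have := max_q p lt_pq; rewrite e insert_fun_eq.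
  case: q => [|q] // in lt_qw max_q le_pq lt_pq *.
  by rewrite insert_fun_gt // ltnNge (ltnW (lt_wN q lt_qw)).
case: ltnP => [lt_qp /lr_maxP[lt_qw max_q]|_ /eqP->].
  split; first by lia.
  move=> i lt_iq; rewrite e !insert_fun_lt //; first exact: max_q.
  exact: ltn_trans lt_qp.
split=> [//|i lt_ip]; rewrite e insert_fun_eq insert_fun_lt //.
by apply: lt_wN; apply: leq_trans le_pw.
Qed.

Lemma lr_count_insert_at N p w : all (fun x => x < N) w -> p <= size w ->
  lr_count (insert_at N p w) = (count (lr_max w) (iota 0 p)).+1.
Proof.
move=> lt_wN le_pw; rewrite /lr_count size_insert_at.
rewrite (_ : (size w).+1 = p + (1 + (size w - p))); last by lia.
rewrite iotaD count_cat iotaD count_cat /= add0n lr_max_insert_at // ltnn eqxx.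
rewrite (_ : count _ (iota (p + 1) _) = 0) ?addn0 ?addn1; last first.
  apply/eqP; rewrite eqn0Ngt -has_count -all_predC; apply/allP=> q.
  rewrite mem_iota => /andP[lt_pq _] /=; rewrite lr_max_insert_at //.
  by rewrite ltnNge (ltnW lt_pq) /= gtn_eqF.
congr _.+1; apply: eq_in_count => q; rewrite mem_iota /= => lt_qp.
by rewrite lr_max_insert_at // lt_qp.
Qed.

(** No right-to-left maximum lies to the left of a left-to-right maximum, so [N] hides none of them
    and adds itself. *)
Lemma lr_count_rev_insert_at N p w : all (fun x => x < N) w -> lr_max w p ->
  lr_count (rev (insert_at N p w)) = (lr_count (rev w)).+1.
Proof.
move=> lt_wN max_p; have [lt_pw lt_p] := lr_maxP _ _ max_p.
rewrite rev_insert_at ?(ltnW lt_pw) // lr_count_insert_at ?all_rev ?size_rev ?leq_subr //.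
congr _.+1; rewrite /lr_count size_rev -{2}(subnK (ltnW lt_pw)) iotaD count_cat.
rewrite (_ : count _ (iota (0 + _) p) = 0) ?addn0 //.
apply/eqP; rewrite eqn0Ngt -has_count -all_predC; apply/allP=> q.
rewrite mem_iota add0n /= subnK ?(ltnW lt_pw) // => /andP[le_q lt_q].
apply/negP; rewrite -(subKn (ltnW lt_q)) => /(rl_maxP (leq_subr _ _))[pos_q max_q].
have := lt_p (size w - q).-1; have := max_q p; lia.
Qed.

(** The rank of a position among those satisfying [P] takes each value exactly once. *)
Lemma sum_rank (phi : nat -> nat) (P : pred nat) n :
  \sum_(0 <= p < n | P p) phi (count P (iota 0 p)) =
  \sum_(i < count P (iota 0 n)) phi i.
Proof.
elim: n => [|n IH]; first by rewrite big_geq // big_ord0.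
have -> : count P (iota 0 n.+1) = count P (iota 0 n) + P n.
  by rewrite -[n.+1]addn1 iotaD count_cat /= addn0.
rewrite big_mkcond big_nat_recr //= -big_mkcond IH; case: (P n); last by rewrite !addn0.
by rewrite addn1 big_ord_recr.
Qed.

Lemma lr_max_rl_maxF w p : p <= size w -> lr_max w p -> rl_max w p = false.
Proof.
move=> le_pw /lr_maxP[lt_pw max_p]; apply/negP=> /(rl_maxP le_pw)[pos_p min_p].
have := min_p p; have := max_p p.-1; lia.
Qed.

Lemma sum_lr_max (phi : nat -> nat -> nat) N w : all (fun x => x < N) w ->
  \sum_(0 <= p < (size w).+1 | lr_max w p)
     phi (lr_count (insert_at N p w)) (lr_count (rev (insert_at N p w))) =
  \sum_(i < lr_count w) phi i.+1 (lr_count (rev w)).+1.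
Proof.
move=> lt_wN; rewrite big_mkcond big_nat_recr //= {2}/lr_max ltnn addn0 -big_mkcond.
rewrite [in RHS]/(lr_count w) -(sum_rank (fun i => phi i.+1 (lr_count (rev w)).+1)).
rewrite big_nat_cond [RHS]big_nat_cond.
apply: eq_bigr => p /andP[/andP[_ lt_pw] max_p].
by rewrite lr_count_insert_at ?(ltnW lt_pw) // lr_count_rev_insert_at.
Qed.

(** This is the succession rule of the tree. Reversal turns sites after right-to-left maxima into
    those of [sum_lr_max], and no site is of both kinds. *)
Lemma sum_active (phi : nat -> nat -> nat) N w : all (fun x => x < N) w ->
  \sum_(0 <= p < (size w).+1 | active w p)
     phi (lr_count (insert_at N p w)) (lr_count (rev (insert_at N p w))) =
  \sum_(i < lr_count w) phi i.+1 (lr_count (rev w)).+1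
  + \sum_(j < lr_count (rev w)) phi (lr_count w).+1 j.+1.
Proof.
move=> lt_wN; rewrite -(sum_lr_max phi lt_wN).
have lt_rN : all (fun x => x < N) (rev w) by rewrite all_rev.
have := sum_lr_max (fun x y => phi y x) lt_rN.
rewrite revK size_rev => <-.
rewrite [X in _ = _ + X]big_nat_rev /= add0n.
rewrite [LHS]big_mkcond [X in _ = X + _]big_mkcond [X in _ = _ + X]big_mkcond.
rewrite -big_split /= !big_nat; apply: eq_bigr => p lt_pw.
have le_pw : p <= size w by [].
rewrite subSS -/(rl_max w p) -rev_insert_at // revK /active.
by case: ifP => [|/negbT]; case max_p: (lr_max w p); rewrite ?addn0 //=;
   [rewrite lr_max_rl_maxF // addn0 | move=> -> | move=> /negbTE->].
Qed.

(** * The generating tree of Baxter words *)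

Fixpoint baxter_tree (n : nat) : seq (seq nat) :=
  if n is n'.+1 then
    [seq insert_at n p w | w <- baxter_tree n',
                           p <- [seq p <- iota 0 n.+1 | active w p]]
  else [:: [:: 0]].

Lemma baxter_treeS n : baxter_tree n.+1 =
  [seq insert_at n.+1 p w | w <- baxter_tree n,
                            p <- [seq p <- iota 0 n.+2 | active w p]].
Proof. by []. Qed.

Lemma mem_baxter_tree n w :
  w \in baxter_tree n <-> perm_eq w (iota 0 n.+1) /\ baxter_seq w.
Proof.
have lt_iota m u : perm_eq u (iota 0 m) -> all (fun x => x < m) u.
  by move=> /perm_all->; apply/allP=> x; rewrite mem_iota.
elim: n w => [|n IH] w.
  rewrite /= inE; split=> [/eqP->|[/perm_small_eq-> //]]; split=> //.
  by move=> i j k; rewrite /=; lia.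
have permE p u : perm_eq u (iota 0 n.+1) =
    perm_eq (insert_at n.+1 p u) (iota 0 n.+2).
  rewrite (permPl (perm_insert_at _ _ _)) -[n.+2]addn1 iotaD.
  by rewrite [in RHS]perm_sym perm_catC perm_cons perm_sym.
split=> [/allpairsPdep[u [p [/IH[perm_u bax_u]]]]|[perm_w bax_w]].
  rewrite mem_filter mem_iota => /andP[act_p /andP[_ le_p]] ->.
  have size_u := perm_size perm_u; rewrite size_iota in size_u.
  split; first by rewrite -permE.
  have uniq_u : uniq u by rewrite (perm_uniq perm_u) iota_uniq.
  have le_pu : p <= size u by rewrite size_u.
  have pos_u : 0 < size u by rewrite size_u.
  exact/(baxter_insert_at uniq_u (lt_iota _ _ perm_u) pos_u le_pu).
have w_in : n.+1 \in w by rewrite (perm_mem perm_w) mem_iota add0n leq0n ltnSn.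
case/splitPr: w_in perm_w bax_w => u v perm_w bax_w.
have def_w : u ++ n.+1 :: v = insert_at n.+1 (size u) (u ++ v).
  by rewrite /insert_at take_size_cat // drop_size_cat.
rewrite def_w -permE in perm_w; rewrite def_w in bax_w *.
have size_w := perm_size perm_w; rewrite size_iota in size_w.
have le_u : size u <= size (u ++ v) by rewrite size_cat leq_addr.
have uniq_uv : uniq (u ++ v) by rewrite (perm_uniq perm_w) iota_uniq.
have pos_uv : 0 < size (u ++ v) by rewrite size_w.
have [bax_uv act_u] :=
  iffLR (baxter_insert_at uniq_uv (lt_iota _ _ perm_w) pos_uv le_u) bax_w.
apply/allpairsPdep; exists (u ++ v), (size u); split=> //; first exact/IH.
by rewrite mem_filter act_u mem_iota /= add0n ltnS -size_w.
Qed.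

(** The position is recovered as the index of [N], and the word by filtering [N] out. *)
Lemma insert_at_inj N p q u v : N \notin u -> N \notin v ->
  p <= size u -> q <= size v -> insert_at N p u = insert_at N q v -> u = v /\ p = q.
Proof.
move=> uN vN le_pu le_qv e.
have idx r t : N \notin t -> r <= size t -> index N (insert_at N r t) = r.
  move=> tN le_rt; rewrite index_cat ifN.
    by rewrite /= eqxx addn0 size_take_min (minn_idPl le_rt).
  by apply: contra tN; apply: mem_take.
have e_pq : p = q by rewrite -(idx p u) // e idx.
split=> //; subst q.
have del t : N \notin t -> filter (predC1 N) (insert_at N p t) = t.
  move=> tN; rewrite filter_cat /= eqxx -filter_cat cat_take_drop.
  by apply/all_filterP/allP=> x x_in; apply: contraNneq tN => <-.
by rewrite -(del u) // e del.
Qed.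

Lemma baxter_tree_bound n w : w \in baxter_tree n ->
  [/\ size w = n.+1, n.+1 \notin w & all (fun x => x < n.+1) w].
Proof.
case/mem_baxter_tree=> perm_w _; split.
- by rewrite (perm_size perm_w) size_iota.
- by rewrite (perm_mem perm_w) mem_iota /= add0n ltnn.
- by rewrite (perm_all _ perm_w); apply/allP=> x; rewrite mem_iota.
Qed.

Lemma baxter_tree_uniq n : uniq (baxter_tree n).
Proof.
elim: n => [|n IH] //; rewrite baxter_treeS; apply: allpairs_uniq_dep => //.
  by move=> w _; rewrite filter_uniq ?iota_uniq.
move=> [u p] [v q] /allpairsPdep[u1 [p1 [u1_in p1_in [-> ->]]]].
case/allpairsPdep=> v1 [q1 [v1_in q1_in [-> ->]]] /= e.
move: p1_in q1_in; rewrite !mem_filter !mem_iota !add0n !ltnS /=.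
move=> /andP[_ le_p] /andP[_ le_q].
have [su uN _] := baxter_tree_bound u1_in.
have [sv vN _] := baxter_tree_bound v1_in.
by have [||-> ->] := insert_at_inj uN vN _ _ e; rewrite ?su ?sv.
Qed.

Lemma lr_count_gt0 w : 0 < size w -> 0 < lr_count w.
Proof.
move=> pos_w; rewrite -has_count; apply/hasP; exists 0; first by rewrite mem_iota.
by rewrite /lr_max pos_w take0.
Qed.

Lemma size_baxter_tree n : size (baxter_tree n) = descendants n 0 0.
Proof.
(* Level [k + m] is counted from level [k]; the predecessors appear because [descendants] takes
   labels lowered by one. *)
suff H m k : size (baxter_tree (k + m)) =
    \sum_(w <- baxter_tree k) descendants m (lr_count w).-1 (lr_count (rev w)).-1.
  by rewrite -[n]add0n H big_seq1.
elim: m k => [|m IH] k; first by rewrite addn0 sum1_size.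
rewrite addnS -addSn IH baxter_treeS big_allpairs_dep.
apply: eq_big_seq => w w_in; have [size_w _ lt_w] := baxter_tree_bound w_in.
rewrite big_filter -[iota 0 k.+2]/(index_iota 0 k.+2) -size_w.
rewrite size_w -{1}size_w (sum_active (fun x y => descendants m x.-1 y.-1) lt_w) /=.
rewrite !prednK //; by apply: lr_count_gt0; rewrite ?size_rev size_w.
Qed.

(** * Permutations as words *)

Definition word_of_perm n (s : 'S_n) : seq nat := [seq val (s i) | i <- enum 'I_n].

Lemma size_word_of_perm n (s : 'S_n) : size (word_of_perm s) = n.
Proof. by rewrite size_map size_enum_ord. Qed.

Lemma nth_word_of_perm n (s : 'S_n) (i : 'I_n) : nth 0 (word_of_perm s) i = s i.
Proof. by rewrite (nth_map i) ?size_enum_ord // nth_ord_enum. Qed.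

Lemma word_of_perm_inj n : injective (@word_of_perm n).
Proof.
move=> s t e; apply/permP=> i; apply: val_inj.
by rewrite /= -!nth_word_of_perm e.
Qed.

Lemma perm_word_of_perm n (s : 'S_n) : perm_eq (word_of_perm s) (iota 0 n).
Proof.
rewrite /word_of_perm map_comp -val_enum_ord; apply: perm_map.
apply: uniq_perm; rewrite ?(map_inj_uniq perm_inj) ?enum_uniq // => i.
rewrite mem_enum; apply/mapP; exists (s^-1 i)%g; rewrite ?mem_enum //.
by rewrite permKV.
Qed.

Lemma word_of_perm_surj n w : perm_eq w (iota 0 n) ->
  exists s : 'S_n, word_of_perm s = w.
Proof.
move=> perm_w; have size_w := perm_size perm_w; rewrite size_iota in size_w.
have uniq_w : uniq w by rewrite (perm_uniq perm_w) iota_uniq.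
have lt_w (i : 'I_n) : nth 0 w i < n.
  have : nth 0 w i \in w by rewrite mem_nth ?size_w.
  by rewrite (perm_mem perm_w) mem_iota.
have inj_w : injective (fun i => Ordinal (lt_w i)).
  by move=> i j [] /eqP; rewrite nth_uniq ?size_w // => /eqP/val_inj.
exists (perm inj_w); apply: (@eq_from_nth _ 0); rewrite size_word_of_perm ?size_w //.
by move=> i lt_in; rewrite (nth_word_of_perm _ (Ordinal lt_in)) permE.
Qed.

Lemma baxter_permP n (s : 'S_n) : baxter_perm s <-> baxter_seq (word_of_perm s).
Proof.
rewrite /baxter_perm /baxter_seq size_word_of_perm; split=> [/existsPn bax|bax].
  move=> i j k lt_ij lt_jk lt_kn; have lt_j1 : j.+1 < n by lia.
  have lt_j : j < n by lia. have lt_i : i < n by lia.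
  move: (bax (Ordinal lt_i)) => /existsPn/(_ (Ordinal lt_j)).
  move=> /existsPn/(_ (Ordinal lt_j1))/existsPn/(_ (Ordinal lt_kn)).
  rewrite /= eqxx lt_ij lt_jk /= -!nth_word_of_perm /=; lia.
apply/existsPn=> i; apply/existsPn=> j; apply/existsPn=> j1; apply/existsPn=> k.
apply/negP=> /and4P[/eqP def_j1 lt_ij lt_jk].
have := bax i j k lt_ij lt_jk (ltn_ord k).
rewrite -def_j1 !nth_word_of_perm; lia.
Qed.

Lemma card_baxter_perm n :
  #|[pred s : 'S_n.+1 | baxter_perm s]| = descendants n 0 0.
Proof.
rewrite -size_baxter_tree cardE -(size_map (@word_of_perm n.+1)).
apply/perm_size/uniq_perm; last 1 first.
- move=> w; apply/mapP/idP=> [[s]|].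
    rewrite mem_enum => /baxter_permP bax_s ->.
    by apply/mem_baxter_tree; split=> //; apply: perm_word_of_perm.
  case/mem_baxter_tree=> /word_of_perm_surj[s <-] /baxter_permP bax_s.
  by exists s; rewrite // mem_enum.
- by rewrite (map_inj_uniq (@word_of_perm_inj _)) enum_uniq.
- exact: baxter_tree_uniq.
Qed.

Theorem theorem2 (n : nat) :
  (exists2 c : nat,
     (two_row_hesitating_tableaux n #= `I_c)%card
   & (c%:R = baxter_number n.+1)%R)
  /\ (#|[pred s : 'S_n.+1 | baxter_perm s]|%:R = baxter_number n.+1)%R.
Proof.
split.
  exists (count final_one_row (double_walks n (0, 0))); first exact: card_tableaux.
  by rewrite -quadrant_walks_baxter -count_final_one_row.
by rewrite card_baxter_perm -quadrant_walks_baxter -descendants_root.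
Qed.
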